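(* Let $f:X\to X$ be a continuous map of a compact metric space, and let $\{\mathcal G_k\}$ be a collection of grids for $X$, partially ordered by refinement. For each $k$, let $\mathcal F^{\mathcal G_k}:\mathcal G_k\rightrightarrows\mathcal G_k$ be the minimal multivalued map associated to $f$ on $\mathcal G_k$, with Morse graph $\mathsf M^{\mathcal G_k}$. Then for every $\mathcal G_{k_1}<\mathcal G_{k_2}$ there are homomorphisms $(\mathsf h_{\mathcal G_{k_1}}^{\mathcal G_{k_2}})_*:H_*(\mathsf M^{\mathcal G_{k_1}})\to H_*(\mathsf M^{\mathcal G_{k_2}})$, induced by the Morse graph maps $\mathsf h_{\mathcal G_{k_1}}^{\mathcal G_{k_2}}:\mathsf M^{\mathcal G_{k_1}}\to\mathsf M^{\mathcal G_{k_2}}$, such that $(\mathsf h_{\mathcal G_{k_2}}^{\mathcal G_{k_3}})_*\circ(\mathsf h_{\mathcal G_{k_1}}^{\mathcal G_{k_2}})_*=(\mathsf h_{\mathcal G_{k_1}}^{\mathcal G_{k_3}})_*$ for any $\mathcal G_{k_1}<\mathcal G_{k_2}<\mathcal G_{k_3}$.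
   Context: A grid $\mathcal G$ on a compact metric space $X$ is a finite collection of nonempty compact subsets of $X$ such that (1) $X=\bigcup_{G\in\mathcal G}G$; (2) $G=\operatorname{cl}(\operatorname{int}(G))$ for all $G\in\mathcal G$; (3) $G\cap\operatorname{int}(H)=\emptyset$ for all $G\ne H$ in $\mathcal G$. For grids $\mathcal G,\mathcal G'$ on $X$, $\mathcal G$ refines $\mathcal G'$, written $\mathcal G<\mathcal G'$, if for every $G\in\mathcal G$ there is $G'\in\mathcal G'$ with $G\subset G'$. The minimal multivalued map associated to $f$ on $\mathcal G$ is $\mathcal F^{\mathcal G}(G):=\{H\in\mathcal G: H\cap f(G)\neq\emptyset\}$, identified with the directed graph on $\mathcal G$ with an edge $G\to H$ whenever $H\in\mathcal F^{\mathcal G}(G)$. An orbit is a sequence $\{G_i\}$ with $G_{i+1}\in\mathcal F^{\mathcal G}(G_i)$. The Morse sets $\mathcal S^{\mathcal G}_i$ of the finest Morse decomposition are the nontrivial strongly connected components of this graph (a single vertex with a loop counts as nontrivial), partially ordered by $\mathcal S_j\succeq\mathcal S_k$ iff there is an orbit from $\mathcal S_j$ to $\mathcal S_k$. The Morse graph $\mathsf M^{\mathcal G}$ is the directed graph with vertex set $\{v_i=\mathcal S_i^{\mathcal G}\}$ and an edge from $v_i$ to $v_j$ if $\mathcal S_i^{\mathcal G}\succ\mathcal S_j^{\mathcal G}$, i.e. $i\neq j$ and there is an orbit from $\mathcal S^{\mathcal G}_i$ to $\mathcal S^{\mathcal G}_j$. For $\mathcal G<\mathcal G'$, the map $h:\mathcal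 G\to\mathcal G'$ sending $G$ to the element of $\mathcal G'$ containing it sends each Morse set of $\mathcal G$ into a single Morse set of $\mathcal G'$, and $\mathsf h_{\mathcal G}^{\mathcal G'}:\mathsf M^{\mathcal G}\to\mathsf M^{\mathcal G'}$ is the resulting map on vertices; it sends each edge to an edge, or collapses it to a vertex if its endpoints have the same image. $H_*$ denotes the homology of the Morse graph regarded as an undirected graph (one-dimensional complex), with $\mathbb R$ coefficients. *)

(* Defs.v *)
From HB Require Import structures.
From mathcomp Require Import all_boot all_order all_algebra.
From mathcomp Require Import finmap generic_quotient ring_quotient.
From mathcomp Require Import all_classical all_reals all_analysis.

Set Implicit Arguments.
Unset Strict Implicit.
Unset Printing Implicit Defensive.

Import Order.TTheory GRing.Theory Num.Theory.

Local Open Scope classical_set_scope.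
Local Open Scope ring_scope.

Section Grid.
Variable X : topologicalType.

Record grid := Grid {
  grid_elements :> {fset set X};
  grid_neq0 : forall A, A \in grid_elements -> A !=set0;
  grid_compact : forall A, A \in grid_elements -> compact A;
  grid_cover : [set: X] = \bigcup_(A in [set` grid_elements]) A;
  grid_regular : forall A, A \in grid_elements -> A = closure (interior A);
  grid_disjoint : forall A B, A \in grid_elements -> B \in grid_elements ->
    A <> B -> A `&` interior B = set0 }.

Definition refines (g g' : grid) : Prop :=
  forall A : g, exists B : g', val A `<=` val B.

Lemma refines_trans g1 g2 g3 :
  refines g1 g2 -> refines g2 g3 -> refines g1 g3.
Proof.
by move=> r12 r23 A; have [B AB] := r12 A; have [C BC] := r23 B;
   exists C => x /AB /BC.
Qed.

(* The element of [g'] containing [A] is unique: if [B] and [C] both contain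
   [A], then int A is included in [B `&` int C], which is empty unless
   [B = C], and [A = cl (int A)] is nonempty. *)
Definition grid_map g g' (r : refines g g') (A : g) : g' := projT1 (cid (r A)).

Lemma grid_mapP g g' (r : refines g g') (A : g) :
  val A `<=` val (grid_map r A).
Proof. exact: (projT2 (cid (r A))). Qed.

End Grid.

(* A finite directed graph without loops and without pairs of opposite arcs:
   a simple graph with a chosen orientation of each edge. *)
Record ograph := Ograph {
  vert :> finType;
  oarc : rel vert;
  oarc_asym : forall u v, oarc u v -> ~~ oarc v u }.

Record gmap (G H : ograph) := Gmap {
  gmap_vert :> G -> H;
  gmap_arc : forall u v, oarc u v ->
    oarc (gmap_vert u) (gmap_vert v) \/ gmap_vert u = gmap_vert v }.

Section MorseGraph.
Variables (X : topologicalType) (f : X -> X).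

Section OneGrid.
Variable g : grid X.

Definition min_map (A : g) : {set g} :=
  [set B : g | `[< val B `&` (f @` val A) !=set0 >]]%SET.

Definition step : rel g := [rel A B | B \in min_map A].

Definition scc (A : g) : {set g} :=
  [set B | connect step A B && connect step B A]%SET.

Definition is_morse_set (S : {set g}) : bool :=
  [exists A, (S == scc A) && ((1 < #|S|)%N || step A A)].

Definition morse_set := {S : {set g} | is_morse_set S}.

Definition morse_arc : rel morse_set := fun S T =>
  (S != T) && [exists A in val S, [exists B in val T, connect step A B]].

Lemma scc_id A : A \in scc A.
Proof. by rewrite inE connect0. Qed.

Lemma morse_setP (S : morse_set) A : A \in val S -> val S = scc A.
Proof.
case: S => S /= /existsP[B /andP[/eqP-> _]]; rewrite inE => /andP[BA AB].
apply/setP => C; rewrite !inE; apply/andP/andP => -[h1 h2]; split.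
- exact: connect_trans AB h1.
- exact: connect_trans h2 BA.
- exact: connect_trans BA h1.
- exact: connect_trans h2 AB.
Qed.

Lemma morse_arc_asym S T : morse_arc S T -> ~~ morse_arc T S.
Proof.
case/andP=> ST /existsP[A /andP[AS /existsP[B /andP[BT AB]]]].
apply/negP => /andP[_ /existsP[B' /andP[B'T /existsP[A' /andP[A'S BA]]]]].
move/negP: ST; apply; apply/eqP/val_inj.
suff BS : B \in val S by rewrite (morse_setP BS) (morse_setP BT).
rewrite (morse_setP AS) inE AB /=.
move: B'T; rewrite (morse_setP BT) inE => /andP[BB' _].
move: A'S; rewrite (morse_setP AS) inE => /andP[_ A'A].
exact: connect_trans BB' (connect_trans BA A'A).
Qed.

Definition morse_graph : ograph := Ograph morse_arc_asym.

End OneGrid.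

Section MorseMap.
Variables (g g' : grid X) (r : refines g g').

Lemma step_grid_map (A B : g) :
  step A B -> step (grid_map r A) (grid_map r B).
Proof.
rewrite /step /= !inE => -[x [Bx [y Ay fyx]]].
exists (f y); split; first by apply: grid_mapP; rewrite fyx.
by exists y => //; exact: grid_mapP.
Qed.

Lemma connect_grid_map (A B : g) :
  connect (@step g) A B -> connect (@step g') (grid_map r A) (grid_map r B).
Proof.
case/connectP => p; elim: p A => [|C p IH] A /= => [_ -> //|/andP[AC pC] BE].
exact: connect_trans (connect1 (step_grid_map AC)) (IH _ pC BE).
Qed.

Lemma morse_map_subproof (S : morse_set g) :
  exists T : morse_set g', forall A, A \in val S -> grid_map r A \in val T.
Proof.
case: S => S /= /existsP[A /andP[/eqP SA nt]].
have hS B : B \in S -> grid_map r B \in scc (grid_map r A).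
  by rewrite SA !inE => /andP[AB BA]; rewrite !connect_grid_map.
suff ms : is_morse_set (scc (grid_map r A)) by exists (Sub _ ms) => B /hS.
apply/existsP; exists (grid_map r A); rewrite eqxx /=.
case/orP: nt => [gt1|/step_grid_map ->]; last by rewrite orbT.
have [C AC CS] : exists2 C, step A C & C \in S.
  have [B BS nBA] : exists2 B, B \in S & B != A.
    have : (0 < #|S :\ A|)%N.
      by move: gt1; rewrite (cardsD1 A S) SA scc_id add1n ltnS.
    by case/card_gt0P => B; rewrite !inE => /andP[? ?]; exists B.
  move: BS; rewrite SA inE => /andP[/connectP[[|C p] /= ] ].
    by move=> _ BA; rewrite BA eqxx in nBA.
  move=> /andP[AC pC] BE BA; exists C => //; rewrite inE connect1 //=.
  by apply: connect_trans BA; apply/connectP; exists p.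
have [hCA|nCA] := eqVneq (grid_map r C) (grid_map r A).
  by rewrite -{3}hCA step_grid_map // orbT.
rewrite (cardsD1 (grid_map r A)) scc_id add1n ltnS.
by apply/orP; left; apply/card_gt0P; exists (grid_map r C); rewrite in_setD1 nCA hS.
Qed.

Definition morse_map_vert (S : morse_graph g) : morse_graph g' :=
  projT1 (cid (morse_map_subproof S)).

Lemma morse_map_vertP (S : morse_graph g) (A : g) :
  A \in val S -> grid_map r A \in val (morse_map_vert S).
Proof. exact: (projT2 (cid (morse_map_subproof S))). Qed.

Lemma morse_map_arc (S T : morse_graph g) : oarc S T ->
  oarc (morse_map_vert S) (morse_map_vert T) \/
  morse_map_vert S = morse_map_vert T.
Proof.
case/andP=> _ /existsP[A /andP[AS /existsP[B /andP[BT AB]]]].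
have [->|nST] := eqVneq (morse_map_vert S) (morse_map_vert T); first by right.
left; rewrite /oarc /= /morse_arc nST; apply/existsP; exists (grid_map r A).
rewrite morse_map_vertP //; apply/existsP; exists (grid_map r B).
by rewrite morse_map_vertP // connect_grid_map.
Qed.

Definition morse_map : gmap (morse_graph g) (morse_graph g') :=
  Gmap morse_map_arc.

End MorseMap.
End MorseGraph.

Section Homology.
Variable R : fieldType.

(* The [n]-cells of an oriented graph seen as a one-dimensional complex. Arcs
   are pairs (source, target). *)
Definition gcell (G : ograph) (n : nat) : finType :=
  match n with
  | 0 => vert G
  | 1 => {e : G * G | oarc e.1 e.2}
  | _ => void
  end.

Notation chain G n := {ffun gcell G n -> R^o}.

Definition incidence (G : ograph) (n : nat) :
    gcell G n.+1 -> gcell G n -> R :=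
  match n with
  | 0 => fun e v => (v == (val e).2)%:R - (v == (val e).1)%:R
  | _ => fun _ _ => 0
  end.

Definition gboundary (G : ograph) (n : nat) (c : chain G n.+1) : chain G n :=
  [ffun x => \sum_e c e * incidence e x].

Lemma boundary_is_linear G n : linear (@gboundary G n).
Proof.
move=> a c d; apply/ffunP => x; rewrite !ffunE scaler_sumr -big_split /=.
by apply: eq_bigr => e _; rewrite !ffunE mulrDl -scalerAl.
Qed.

HB.instance Definition _ G n := GRing.isLinear.Build R
  {ffun gcell G n.+1 -> R^o} {ffun gcell G n -> R^o} *:%R (@gboundary G n)
  (@boundary_is_linear G n).

Definition cycles (G : ograph) (n : nat) : {vspace chain G n} :=
  match n with
  | 0 => fullv
  | m.+1 => lker (linfun (@gboundary G m))
  end.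

Definition boundaries (G : ograph) (n : nat) : {vspace chain G n} :=
  limg (linfun (@gboundary G n)).

Definition cycle_of (G : ograph) (n : nat) := subvs_of (cycles G n).

HB.instance Definition _ G n := Vector.on (cycle_of G n).

Definition is_boundary (G : ograph) (n : nat) : {pred cycle_of G n} :=
  fun z => vsval z \in boundaries G n.

Lemma is_boundary_zmod_closed G n : zmod_closed (@is_boundary G n).
Proof.
split=> [|x y]; rewrite -!topredE /= /is_boundary; first exact: mem0v.
exact: rpredB.
Qed.

HB.instance Definition _ G n := GRing.isZmodClosed.Build (cycle_of G n)
  (@is_boundary G n) (@is_boundary_zmod_closed G n).

Definition homology (G : ograph) (n : nat) := Quotient.quot (@is_boundary G n).

HB.instance Definition _ G n := GRing.Zmodule.on (homology G n).

Definition hclass (G : ograph) (n : nat) (z : cycle_of G n) : homology G n :=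
  (\pi_(Quotient.quot (@is_boundary G n)) z)%qT.

Lemma hclassP G n (x y : cycle_of G n) :
  hclass x = hclass y <-> vsval x - vsval y \in boundaries G n.
Proof.
rewrite -[_ \in _]/(x - y \in @is_boundary G n) Quotient.idealrBE.
by split => [|/eqP//]; move=> /eqP.
Qed.

Lemma hclassD G n : {morph @hclass G n : x y / x + y}.
Proof. exact: Quotient.pi_add. Qed.

Definition hscale G n (a : R) (x : homology G n) : homology G n :=
  hclass (a *: repr (x : Quotient.quot (@is_boundary G n))).

Lemma hscaleE G n a (z : cycle_of G n) : hscale a (hclass z) = hclass (a *: z).
Proof.
apply/hclassP; rewrite -linearB -scalerBr linearZ memvZ // linearB.
by apply/hclassP; rewrite /hclass reprK.
Qed.

Lemma hclass_surj G n (x : homology G n) : exists z, x = hclass z.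
Proof. by exists (repr (x : Quotient.quot _)); rewrite /hclass reprK. Qed.

Lemma hscaleA G n a b (x : homology G n) :
  hscale a (hscale b x) = hscale (a * b) x.
Proof. by have [z ->] := hclass_surj x; rewrite !hscaleE scalerA. Qed.

Lemma hscale1 G n : left_id 1 (@hscale G n).
Proof. by move=> x; have [z ->] := hclass_surj x; rewrite hscaleE scale1r. Qed.

Lemma hscaleDr G n : right_distributive (@hscale G n) +%R.
Proof.
move=> a x y; have [z ->] := hclass_surj x; have [t ->] := hclass_surj y.
by rewrite -hclassD !hscaleE scalerDr hclassD.
Qed.

Lemma hscaleDl G n (x : homology G n) :
  {morph (@hscale G n)^~ x : a b / a + b}.
Proof.
by move=> a b; have [z ->] := hclass_surj x; rewrite !hscaleE scalerDl hclassD.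
Qed.

HB.instance Definition _ G n := GRing.Zmodule_isLmodule.Build R (homology G n)
  (@hscaleA G n) (@hscale1 G n) (@hscaleDr G n) (@hscaleDl G n).

(* [carries h x y]: the graph map [h] sends the cell [x] onto the cell [y].
   An arc whose endpoints have the same image is carried to no arc, hence
   contributes 0 to [push]. *)
Definition carries (G H : ograph) (h : gmap G H) (n : nat) :
    gcell G n -> gcell H n -> bool :=
  match n with
  | 0 => fun v w => h v == w
  | 1 => fun e e' => (h (val e).1, h (val e).2) == val e'
  | _ => fun _ _ => false
  end.

Definition push (G H : ograph) (h : gmap G H) (n : nat) (c : chain G n) :
    chain H n :=
  [ffun y => \sum_(x | carries h x y) c x].

(* The first component says in particular that [push h] maps cycles to
   cycles. *)
Definition induced_by (G H : ograph) (h : gmap G H) (n : nat)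
    (phi : homology G n -> homology H n) : Prop :=
  forall z : cycle_of G n, exists2 z' : cycle_of H n,
    vsval z' = push h (vsval z) & phi (hclass z) = hclass z'.

End Homology.

(* Main.v *)
From HB Require Import structures.
Require Import Defs.
From mathcomp Require Import all_boot all_order all_algebra.
From mathcomp Require Import finmap generic_quotient ring_quotient.
From mathcomp Require Import all_classical all_reals all_analysis.

(* A graph map that sends every arc to an arc or to a vertex is a chain map, so
   it acts on homology. The chain map of a composite is the composite of the
   chain maps, as an arc that is collapsed by the first map is collapsed by the
   composite. It remains to see that Morse graph maps compose: a nonempty
   regular closed set lies in at most one grid element, so the maps between
   grids compose, and a Morse set is determined by any of its elements. *)

Local Open Scope classical_set_scope.
Local Open Scope ring_scope.

Import GRing.Theory.

Set Implicit Arguments.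
Unset Strict Implicit.
Unset Printing Implicit Defensive.

Section MorseMapComp.
Variable X : topologicalType.

(** Being nonempty and the closure of its interior, [A] has an interior point. It lies in [B] and in
    the interior of [C], which are disjoint if [B] and [C] differ. *)
Lemma grid_element_uniq (g g' : grid X) (A : g) (B C : g') :
  val A `<=` val B -> val A `<=` val C -> B = C.
Proof.
move=> AB AC; apply/val_inj; apply: contrapT => nBC.
have /(_ nBC) disjBC := @grid_disjoint _ g' _ _ (valP B) (valP C).
have [x xA] : (val A)^° !=set0.
  apply/set0P/negP => /eqP A0; have := grid_regular (valP A).
  by rewrite A0 closure0 => E; have := grid_neq0 (valP A); rewrite E => -[x].
have : (val B `&` (val C)^°) x.
  by split; [exact: AB (interior_subset xA) | exact: interiorS xA].
by rewrite disjBC.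
Qed.

(** [grid_map] is obtained by choice, so the two sides are compared by uniqueness: both contain
    [A]. *)
Lemma grid_map_comp (g1 g2 g3 : grid X) (r12 : refines g1 g2)
    (r23 : refines g2 g3) (r13 : refines g1 g3) (A : g1) :
  grid_map r23 (grid_map r12 A) = grid_map r13 A.
Proof.
apply: (grid_element_uniq (A := A)); last exact: grid_mapP.
by move=> x /(@grid_mapP _ _ _ r12) /(@grid_mapP _ _ _ r23).
Qed.

Lemma morse_set_inhabited (f : X -> X) (g : grid X) (S : morse_set f g) :
  exists A, A \in val S.
Proof.
by case: S => S /= /existsP[A /andP[/eqP-> _]]; exists A; exact: scc_id.
Qed.

Lemma morse_set_eq (f : X -> X) (g : grid X) (S T : morse_set f g) (A : g) :
  A \in val S -> A \in val T -> S = T.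
Proof. by move=> AS AT; apply/val_inj; rewrite (morse_setP AS) (morse_setP AT). Qed.

Lemma morse_map_comp (f : X -> X) (g1 g2 g3 : grid X) (r12 : refines g1 g2)
    (r23 : refines g2 g3) (r13 : refines g1 g3) (S : morse_graph f g1) :
  morse_map f r23 (morse_map f r12 S) = morse_map f r13 S.
Proof.
have [A AS] := morse_set_inhabited S.
apply: (morse_set_eq (A := grid_map r13 A)); last exact: morse_map_vertP.
by rewrite -(grid_map_comp r12 r23); do 2 apply: morse_map_vertP.
Qed.

End MorseMapComp.

Lemma oarc_neq (G : ograph) (u v : G) : oarc u v -> u != v.
Proof. by move=> uv; apply/eqP => E; have := oarc_asym uv; rewrite -E {2}E uv. Qed.

Section Carries.
Variables (G H : ograph) (h : gmap G H).

(** Reduces sums over the cells that [x] is carried to to at most one term. *)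
Lemma carries_fun n (x : gcell G n) (y z : gcell H n) :
  carries h x y -> carries h x z -> y = z.
Proof.
case: n x y z => [|[|n]] //= x y z /eqP xy /eqP xz; first by rewrite -xy -xz.
by apply: val_inj; rewrite /= -xy -xz.
Qed.

Lemma arc_carries (e : gcell G 1) :
  h (val e).1 != h (val e).2 -> exists e' : gcell H 1, carries h e e'.
Proof.
move=> ne; have [he|E] := gmap_arc h (valP e); last by rewrite E eqxx in ne.
by exists (exist (fun e : H * H => oarc e.1 e.2) (_, _) he) => /=.
Qed.

Lemma carries_comp (I : ograph) (k : gmap H I) (l : gmap G I) :
    (forall v, l v = k (h v)) ->
  forall n (x : gcell G n) (y : gcell I n),
    carries l x y <-> exists2 z, carries h x z & carries k z y.
Proof.
move=> lE [|[|n]] //= x y; split.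
- by rewrite lE => hx; exists (h x).
- by case=> z /eqP<-; rewrite lE.
(* The image of [x] under [l] is an arc, so its endpoints differ; hence [h] cannot have collapsed
   [x], and the arc it carries [x] to is the required middle cell. *)
- move/eqP=> xy; have : l (val x).1 != l (val x).2.
    by have := oarc_neq (valP y); rewrite /= -xy.
  rewrite !lE => ne; have [|z xz] := arc_carries (e := x).
    by apply: contraNneq ne => ->.
  by exists z => //; move/eqP: xz => /= <-; rewrite -xy !lE.
- by case=> z /eqP xz /eqP<-; rewrite -xz !lE.
Qed.

Variable R : fieldType.

(** The chain map identity for a single cell [e], read off at [y]. Only arcs matter, as [incidence]
    vanishes in higher degrees. *)
Lemma sum_carries_incidence n (e : gcell G n.+1) (y : gcell H n) :
  \sum_(e' | carries h e e') incidence R e' y =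
  \sum_(x | carries h x y) incidence R e x.
Proof.
case: n e y => [|n]; last by move=> e y; rewrite !big1.
move=> e w.
have sumE (v : G) : \sum_(x | h x == w) ((x == v)%:R : R) = (w == h v)%:R.
  rewrite big_mkcond (bigD1 v) //= eqxx big1 ?addr0; first by case: eqVneq.
  by move=> x /negPf->; case: ifP.
rewrite [RHS]sumrB /= !sumE.
(* If [h] collapses [e], the endpoint terms cancel on the right and the sum on the left is empty,
   since no arc is a loop. *)
have [E|ne] := eqVneq (h (val e).1) (h (val e).2).
  rewrite E subrr big_pred0 // => e'; apply/negP => /eqP ee'.
  by have /eqP[] := oarc_neq (valP e'); rewrite /= -ee'.
have [e' ee'] := arc_carries ne; rewrite (big_pred1 e').
  by move/eqP: ee' => <-.
by move=> t; apply/idP/eqP => [et|->//]; exact: (carries_fun (n := 1) et ee').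
Qed.

End Carries.

Section Push.
Variable R : fieldType.
Notation chain G n := {ffun gcell G n -> R^o}.

Section OneMap.
Variables (G H : ograph) (h : gmap G H).

Lemma push_is_linear n : linear (@push R G H h n).
Proof.
move=> a c d; apply/ffunP => x; rewrite !ffunE scaler_sumr -big_split /=.
by apply: eq_bigr => e _; rewrite !ffunE.
Qed.

HB.instance Definition _ n := GRing.isLinear.Build R
  {ffun gcell G n -> R^o} {ffun gcell H n -> R^o} *:%R (@push R G H h n)
  (@push_is_linear n).

Lemma push_boundary n (c : chain G n.+1) :
  gboundary (push h c) = push h (gboundary c).
Proof.
apply/ffunP => y; rewrite !ffunE.
under eq_bigr do rewrite ffunE mulr_suml.
(* With the sum over the cells [e] of [G] outermost on both sides, the claim reduces to one cell. *)
rewrite (exchange_big_dep xpredT) //=.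
under [RHS]eq_bigr do rewrite ffunE.
rewrite [RHS]exchange_big /=; apply: eq_bigr => e _.
by rewrite -!mulr_sumr sum_carries_incidence.
Qed.

Lemma push_cycles n (c : chain G n) :
  c \in cycles R G n -> push h c \in cycles R H n.
Proof.
case: n c => [|n] c; first by move=> _; exact: memvf.
by rewrite /= !memv_ker !lfunE /= push_boundary => /eqP->; rewrite linear0.
Qed.

Lemma push_boundaries n (c : chain G n) :
  c \in boundaries R G n -> push h c \in boundaries R H n.
Proof.
move=> /memv_imgP[d _ ->]; rewrite lfunE /= -push_boundary.
by apply/memv_imgP; exists (push h d); rewrite ?memvf // lfunE.
Qed.

Definition push_cycle n (z : cycle_of R G n) : cycle_of R H n :=
  Sub (push h (vsval z)) (push_cycles (valP z)).

Definition hmap n (x : homology R G n) : homology R H n :=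
  hclass (push_cycle (repr (x : Quotient.quot (@is_boundary R G n)))).

(** Independence of the representative: two of them differ by a boundary, and [push] preserves
    boundaries. *)
Lemma hmapE n (z : cycle_of R G n) : hmap (hclass z) = hclass (push_cycle z).
Proof.
apply/hclassP; rewrite /= -linearB; apply: push_boundaries.
by apply/hclassP; rewrite /hclass reprK.
Qed.

Lemma hmap_is_linear n : linear (@hmap n).
Proof.
move=> a x y; have [z ->] := hclass_surj x; have [t ->] := hclass_surj y.
rewrite -[a *: hclass z]/(hscale a (hclass z)) hscaleE -hclassD !hmapE.
rewrite -[a *: hclass _]/(hscale a (hclass _)) hscaleE -hclassD.
by congr hclass; apply: val_inj; rewrite /= !linearP.
Qed.

HB.instance Definition _ n := GRing.isLinear.Build R
  (homology R G n) (homology R H n) *:%R (@hmap n) (@hmap_is_linear n).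

Lemma hmap_induced n : induced_by h (@hmap n).
Proof. by move=> z; exists (push_cycle z) => //; exact: hmapE. Qed.

End OneMap.

Section Comp.
Variables (G H I : ograph) (h : gmap G H) (k : gmap H I) (l : gmap G I).
Hypothesis lE : forall v, l v = k (h v).

Lemma push_comp n (c : chain G n) : push k (push h c) = push l c.
Proof.
apply/ffunP => y; rewrite !ffunE.
under eq_bigr do rewrite ffunE.
rewrite (exchange_big_dep xpredT) //= [RHS]big_mkcond; apply: eq_bigr => x _.
(* The coefficient [c x] is counted once, through the unique middle cell [z], if [l] carries [x] to
   [y], and not at all otherwise. *)
case: ifPn => [/(carries_comp lE)[z xz zy]|nxy].
  rewrite (big_pred1 z) // => t; apply/andP/eqP => [[_ xt]|->//].
  exact: carries_fun xt xz.
rewrite big_pred0 // => z; apply: contraNF nxy => /andP[zy xz].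
by apply/(carries_comp lE); exists z.
Qed.

Lemma hmap_comp n : @hmap _ _ k n \o @hmap _ _ h n =1 @hmap _ _ l n.
Proof.
move=> x; have [z ->] := hclass_surj x; rewrite /= !hmapE.
by congr hclass; apply: val_inj; rewrite /= push_comp.
Qed.

End Comp.
End Push.

Theorem proposition5p5 (R : realType) (X : metricType R)
    (X_compact : compact [set: X]) (f : X -> X) (f_cont : continuous f)
    (K : Type) (G : K -> grid X) :
  exists hs : forall k1 k2 : K, refines (G k1) (G k2) -> forall n : nat,
      {linear homology R (morse_graph f (G k1)) n ->
              homology R (morse_graph f (G k2)) n},
    (forall (k1 k2 : K) (r : refines (G k1) (G k2)) (n : nat),
       induced_by (morse_map f r) (hs k1 k2 r n)) /\
    (forall (k1 k2 k3 : K) (r12 : refines (G k1) (G k2))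
       (r23 : refines (G k2) (G k3)) (n : nat),
       hs k2 k3 r23 n \o hs k1 k2 r12 n =1
       hs k1 k3 (refines_trans r12 r23) n).
Proof.
exists (fun k1 k2 r n => @hmap R _ _ (morse_map f r) n).
split=> [k1 k2 r n|k1 k2 k3 r12 r23 n]; first exact: hmap_induced.
(* [morse_map_comp] accepts any proof of the composite refinement, in particular
   [refines_trans r12 r23]. *)
by apply: hmap_comp => S; exact/esym/morse_map_comp.
Qed.
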